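(* Let $k$ be a field, $\mathsf{C}$ a $k$-linear abelian category and $\underline{\mathcal{L}}=(\mathcal{L}_i)_{i\in\mathbb{Z}}$ a sequence of objects of $\mathsf{C}$. Then composition of morphisms in $\mathsf{C}$ induces a homomorphism of $\mathbb{Z}$-algebras $$\mathbb{S}^{nc}(\underline{\mathcal{L}})\to B_{\underline{\mathcal{L}}}$$ which is an isomorphism in degrees zero and one (that is, on the $(i,i)$- and $(i,i+1)$-components for all $i\in\mathbb{Z}$).
   Context: A $\mathbb{Z}$-algebra over $k$ is a ring $A=\bigoplus_{i,j\in\mathbb{Z}}A_{ij}$ (of $k$-vector spaces) with $A_{ij}A_{jl}\subseteq A_{il}$, $A_{ij}A_{ml}=0$ for $j\neq m$, and local units $e_i\in A_{ii}$ (equivalently a $k$-linear pre-additive category with objects indexed by $\mathbb{Z}$). Put $D_i=\operatorname{End}\mathcal{L}_i$. The orbit algebra $B_{\underline{\mathcal{L}}}$ is the $\mathbb{Z}$-algebra with $(B_{\underline{\mathcal{L}}})_{ij}=\operatorname{Hom}(\mathcal{L}_{-j},\mathcal{L}_{-i})$ and multiplication induced by composition. The noncommutative symmetric algebra $\mathbb{S}^{nc}(\underline{\mathcal{L}})$ is the $\mathbb{Z}$-algebra with $(i,i)$-component $D_{-i}$, generated in its $(-(i+1),-i)$-component by the $D_{i+1}$-$D_i$-bimodule $\operatorname{Hom}(\mathcal{L}_i,\mathcal{L}_{i+1})$ for all $i$ (i.e. a quotient of the tensor $\mathbb{Z}$-algebra on these bimodules), with relations generated by the kernels of the compositions $\operatorname{Hom}(\mathcal{L}_{i+1},\mathcal{L}_{i+2})\otimes_{D_{i+1}}\operatorname{Hom}(\mathcal{L}_i,\mathcal{L}_{i+1})\to\operatorname{Hom}(\mathcal{L}_i,\mathcal{L}_{i+2})$.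 *)

(* Defs.v *)
From HB Require Import structures.
From mathcomp Require Import all_boot all_algebra.
From mathcomp Require Import generic_quotient ring_quotient.
From mathcomp Require Import boolp.
From mathcomp Require Import freeg.

Set Implicit Arguments.
Unset Strict Implicit.
Unset Printing Implicit Defensive.

Import GRing.Theory.
Local Open Scope ring_scope.
Local Open Scope quotient_scope.

Record submod (k : fieldType) (V : lmodType k) := Submod {
  smem :> V -> Prop;
  smem0 : smem 0;
  smem_lin : forall (a : k) u v, smem u -> smem v -> smem (a *: u + v)
}.

Inductive lspan (k : fieldType) (V : lmodType k) (X : V -> Prop) : V -> Prop :=
| span_gen v : X v -> lspan X v
| span_0 : lspan X 0
| span_lin (a : k) u v : lspan X u -> lspan X v -> lspan X (a *: u + v).

Definition span_submod (k : fieldType) (V : lmodType k) (X : V -> Prop) :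
  submod V := @Submod k V (lspan X) (@span_0 k V X) (@span_lin k V X).

Definition smemb (k : fieldType) (V : lmodType k) (P : submod V) : {pred V} :=
  fun v => `[< P v >].

Lemma smemb_closed (k : fieldType) (V : lmodType k) (P : submod V) :
  submod_closed (smemb P).
Proof.
split; first by apply/asboolP; exact: smem0.
by move=> a u v /asboolP Pu /asboolP Pv; apply/asboolP; exact: smem_lin.
Qed.

HB.instance Definition _ (k : fieldType) (V : lmodType k) (P : submod V) :=
  GRing.isSubmodClosed.Build k V (smemb P) (smemb_closed P).

Section QuotientModule.
Variables (k : fieldType) (V : lmodType k) (P : submod V).

Definition qmod : Type := @Quotient.quot V (smemb P).

HB.instance Definition _ := GRing.Zmodule.on qmod.

Definition qpi (v : V) : qmod := \pi_(@Quotient.quot V (smemb P)) v.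
Definition qrepr (x : qmod) : V := repr x.

Lemma qreprK x : qpi (qrepr x) = x.
Proof. exact: reprK. Qed.

Lemma qpi_eqP u v : qpi u = qpi v <-> P (u - v).
Proof.
split=> [/eqP|H].
  by rewrite /qpi -Quotient.idealrBE => /asboolP.
by apply/eqP; rewrite /qpi -Quotient.idealrBE; apply/asboolP.
Qed.

Lemma qpiD u v : qpi (u + v) = qpi u + qpi v.
Proof. by rewrite /qpi; exact: raddfD. Qed.

Definition qscale (a : k) (x : qmod) : qmod := qpi (a *: qrepr x).

Lemma qpiZ a v : qpi (a *: v) = qscale a (qpi v).
Proof.
apply/qpi_eqP; rewrite -scalerBr.
have /qpi_eqP H : qpi v = qpi (qrepr (qpi v)) by rewrite qreprK.
by rewrite -[_ *: _]addr0; apply: smem_lin => //; exact: smem0.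
Qed.

Lemma qscaleA a b x : qscale a (qscale b x) = qscale (a * b) x.
Proof. by rewrite -[x]qreprK -!qpiZ scalerA. Qed.
Lemma qscale1 : left_id 1 qscale.
Proof. by move=> x; rewrite -[x]qreprK -!qpiZ scale1r. Qed.
Lemma qscaleDr : right_distributive qscale +%R.
Proof.
move=> a x y; rewrite -[x]qreprK -[y]qreprK.
by rewrite -qpiD -!qpiZ -qpiD scalerDr.
Qed.
Lemma qscaleDl x : {morph qscale^~ x : a b / a + b}.
Proof. by move=> a b; rewrite -[x]qreprK -!qpiZ -qpiD scalerDl. Qed.

HB.instance Definition _ := GRing.Zmodule_isLmodule.Build k qmod
  qscaleA qscale1 qscaleDr qscaleDl.

Lemma qpi_lin : linear qpi.
Proof. by move=> a u v; rewrite qpiD qpiZ. Qed.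
HB.instance Definition _ := GRing.isLinear.Build k V qmod *:%R qpi qpi_lin.

(* The map [V / P -> W] induced by [f]; meaningful when [f] is linear and
   kills [P], see [qlift_pi]. *)
Definition qlift (W : lmodType k) (f : V -> W) (x : qmod) : W := f (qrepr x).

Lemma qlift_pi (W : lmodType k) (f : {linear V -> W}) :
  (forall v, P v -> f v = 0) -> forall v, qlift f (qpi v) = f v.
Proof.
move=> fP v; apply/eqP; rewrite -subr_eq0 -linearB; apply/eqP/fP.
by apply/qpi_eqP; rewrite qreprK.
Qed.

End QuotientModule.

Lemma linear_sub (k : fieldType) (V W : lmodType k) (f : V -> W) : linear f ->
  forall a x y z, f (x - (a *: y + z)) = f x - (a *: f y + f z).
Proof.
move=> fl a x y z; have := fl (-1) (a *: y + z) x.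
by rewrite !scaleN1r ![- _ + _]addrC => ->; rewrite fl.
Qed.

Lemma linear_sub1 (k : fieldType) (V W : lmodType k) (f : V -> W) : linear f ->
  forall x y, f (x - y) = f x - f y.
Proof.
move=> fl x y; have := fl (-1) y x.
by rewrite !scaleN1r ![- _ + _]addrC => ->.
Qed.

Lemma span_ker (k : fieldType) (V W : lmodType k) (X : V -> Prop) (f : {linear V -> W}) :
  (forall v, X v -> f v = 0) -> forall v, lspan X v -> f v = 0.
Proof.
move=> Xf v; elim=> [|| a u w _ fu _ fw]; first exact: Xf.
  exact: linear0.
by rewrite linearP fu fw scaler0 addr0.
Qed.

Section FreeModule.
Variables (k : fieldType) (X : choiceType) (W : lmodType k) (f : X -> W).

Lemma fglift_lin : linear (fglift f : {freeg X / k} -> W).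
Proof.
have fD u v : fglift f (u + v) = fglift f u + fglift f v :> W.
  pose g : {additive {freeg X / k} -> W} :=
    HB.pack (fglift f : {freeg X / k} -> W)
     (GRing.isAdditive.Build _ _ _ (lift_is_additive f)).
  exact: (raddfD g).
have f0 : fglift f (0 : {freeg X / k}) = 0 :> W.
  by apply: (addrI (fglift f 0)); rewrite -fD !addr0.
have fS (s : seq X) (F : X -> {freeg X / k}) :
    fglift f (\sum_(x <- s) F x) = \sum_(x <- s) fglift f (F x) :> W.
  by elim: s => [|x s IH]; rewrite ?big_nil // !big_cons fD IH.
move=> a u v; rewrite fD; congr (_ + _).
have -> : a *: u = \sum_(x <- dom u) << a * coeff x u *g x >> by [].
rewrite -{3}[u]freeg_sumE !fS scaler_sumr.
by apply: eq_bigr => x _; rewrite !liftU scalerA.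
Qed.

HB.instance Definition _ :=
  GRing.isLinear.Build k {freeg X / k} W *:%R (fglift f) fglift_lin.

End FreeModule.

Lemma freeg_ind_lin (k : fieldType) (X : choiceType)
    (P : {freeg X / k} -> Prop) :
  P 0 -> (forall (a : k) x v, P v -> P (a *: << x >> + v)) -> forall v, P v.
Proof.
move=> P0 PS v; rewrite -[v]freeg_sumE; elim: (dom v) => [|x s IH].
  by rewrite big_nil.
rewrite big_cons; suff -> : << coeff x v *g x >> = coeff x v *: << x >> :> {freeg X / k}.
  exact: PS.
by apply/eqP/freeg_eqP => y; rewrite coeffZ !coeffU mul1r.
Qed.

(* The zero algebra is allowed (the endomorphism algebra of a zero object is
   zero), which rules out MathComp's [algType]. *)
Record kalg (k : fieldType) := KAlg {
  kalg_mod :> lmodType k;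
  kmul : kalg_mod -> kalg_mod -> kalg_mod;
  kone : kalg_mod;
  kmul_linl : forall y, linear (fun x => kmul x y);
  kmul_linr : forall x, linear (fun y => kmul x y);
  kmulA : associative kmul;
  kmul1x : left_id kone kmul;
  kmulx1 : right_id kone kmul
}.

Record bimod (k : fieldType) (R S : kalg k) := Bimod {
  bimod_mod :> lmodType k;
  lact : R -> bimod_mod -> bimod_mod;
  ract : bimod_mod -> S -> bimod_mod;
  lact_linl : forall m, linear (fun r => lact r m);
  lact_linr : forall r, linear (fun m => lact r m);
  ract_linl : forall s, linear (fun m => ract m s);
  ract_linr : forall m, linear (fun s => ract m s);
  lactA : forall r r' m, lact r (lact r' m) = lact (kmul r r') m;
  ractA : forall m s s', ract (ract m s) s' = ract m (kmul s s');
  lact1 : forall m, lact (kone R) m = m;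
  ract1 : forall m, ract m (kone S) = m;
  lractA : forall r m s, ract (lact r m) s = lact r (ract m s)
}.

Section Tensor.
Variables (k : fieldType) (R S Q : kalg k) (M : bimod R S) (N : bimod S Q).

Definition pureten (m : M) (n : N) : {freeg (M * N)%type / k} := << (m, n) >>.

Inductive tens_rel : {freeg (M * N)%type / k} -> Prop :=
| tens_linl a m m' n : tens_rel
    (pureten (a *: m + m') n - (a *: pureten m n + pureten m' n))
| tens_linr a m n n' : tens_rel
    (pureten m (a *: n + n') - (a *: pureten m n + pureten m n'))
| tens_bal m s n : tens_rel
    (pureten (ract m s) n - pureten m (lact s n)).

Definition tens : lmodType k := qmod (span_submod tens_rel).

(* The map [M (x)_S N -> W] induced by a bilinear balanced [f]. *)
Definition tens_lift (W : lmodType k) (f : M -> N -> W) : tens -> W :=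
  @qlift _ _ (span_submod tens_rel) W (fglift (fun p : M * N => f p.1 p.2)).

Definition tmk (m : M) (n : N) : tens := qpi (span_submod tens_rel) (pureten m n).

Lemma tens_lift_tmk (W : lmodType k) (f : M -> N -> W) :
  (forall n, linear (fun m => f m n)) -> (forall m, linear (f m)) ->
  (forall m s n, f (ract m s) n = f m (lact s n)) ->
  forall m n, tens_lift f (tmk m n) = f m n.
Proof.
move=> fl fr fb m n; rewrite /tens_lift /tmk; set g := fun p => _.
rewrite qlift_pi.
  by rewrite /pureten /= liftU scale1r.
apply: span_ker => _ [a u u' w|a u w w'|u s w];
  rewrite /= ?(linear_sub (fglift_lin g)) ?(linear_sub1 (fglift_lin g));
  rewrite /pureten !liftU !scale1r /g /=.
- by rewrite fl subrr.
- by rewrite fr subrr.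
- by rewrite fb subrr.
Qed.

End Tensor.

(* A Z-algebra in its guise of a k-linear category with object set Z: the
   matrix ring (+)_(i,j) A_ij is encoded by its components, the vanishing
   products A_ij A_ml (j != m) being left out. *)
Record zalg (k : fieldType) := ZAlg {
  zcomp :> int -> int -> lmodType k;
  zmul : forall i j l, zcomp i j -> zcomp j l -> zcomp i l;
  zone : forall i, zcomp i i;
  zmul_linl : forall i j l (y : zcomp j l), linear (fun x : zcomp i j => zmul x y);
  zmul_linr : forall i j l (x : zcomp i j), linear (fun y : zcomp j l => zmul x y);
  zmulA : forall i j l m (x : zcomp i j) (y : zcomp j l) (z : zcomp l m),
    zmul x (zmul y z) = zmul (zmul x y) z;
  zmul1x : forall i j (x : zcomp i j), zmul (zone i) x = x;
  zmulx1 : forall i j (x : zcomp i j), zmul x (zone j) = x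
}.
Arguments zmul {k A i j l} : rename.
Arguments zone {k A} : rename.

Record zhom (k : fieldType) (A B : zalg k) := ZHom {
  zmap :> forall i j, {linear A i j -> B i j};
  zmapM : forall i j l (x : A i j) (y : A j l),
    zmap i l (zmul x y) = zmul (zmap i j x) (zmap j l y);
  zmap1 : forall i, zmap i i (zone i) = zone i
}.

Record zideal (k : fieldType) (A : zalg k) := ZIdeal {
  zid :> forall i j, submod (A i j);
  zidMl : forall i j l (x : A i j) (y : A j l), zid j l y -> zid i l (zmul x y);
  zidMr : forall i j l (x : A i j) (y : A j l), zid i j x -> zid i l (zmul x y)
}.

Inductive zspan (k : fieldType) (A : zalg k) (X : forall i j, A i j -> Prop) :
  forall i j, A i j -> Prop :=
| zspan_gen i j x : X i j x -> zspan X x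
| zspan_0 i j : @zspan k A X i j 0
| zspan_lin i j a (x y : A i j) : zspan X x -> zspan X y -> zspan X (a *: x + y)
| zspanMl i j l (x : A i j) (y : A j l) : zspan X y -> zspan X (zmul x y)
| zspanMr i j l (x : A i j) (y : A j l) : zspan X x -> zspan X (zmul x y).

Definition zideal_gen (k : fieldType) (A : zalg k) (X : forall i j, A i j -> Prop) :
  zideal A :=
  @ZIdeal k A
    (fun i j => @Submod k (A i j) (@zspan k A X i j)
       (@zspan_0 k A X i j) (@zspan_lin k A X i j))
    (@zspanMl k A X) (@zspanMr k A X).

Section ZQuotient.
Variables (k : fieldType) (A : zalg k) (I : zideal A).

Definition zquot_comp (i j : int) : lmodType k := qmod (I i j).

Definition zquot_pi (i j : int) : {linear A i j -> zquot_comp i j} :=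
  @qpi k (A i j) (I i j).

Definition zquot_mul i j l (x : zquot_comp i j) (y : zquot_comp j l) :
  zquot_comp i l := zquot_pi i l (zmul (qrepr x) (qrepr y)).

Lemma zquot_piM i j l (x : A i j) (y : A j l) :
  zquot_pi i l (zmul x y) = zquot_mul (zquot_pi i j x) (zquot_pi j l y).
Proof.
rewrite /zquot_mul; set x' := qrepr _; set y' := qrepr _.
have Ix : I i j (x - x') by apply/qpi_eqP; rewrite qreprK.
have Iy : I j l (y - y') by apply/qpi_eqP; rewrite qreprK.
apply/qpi_eqP.
have -> : zmul x y - zmul x' y' = 1 *: zmul (x - x') y + zmul x' (y - y').
  rewrite scale1r (linear_sub1 (zmul_linl y)) (linear_sub1 (zmul_linr x')).
  by rewrite addrA subrK.
by apply: smem_lin; [exact: zidMr | exact: zidMl].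
Qed.

Lemma zquot_pi_ind i j (P : zquot_comp i j -> Prop) :
  (forall x, P (zquot_pi i j x)) -> forall x, P x.
Proof. by move=> H x; rewrite -[x]qreprK; exact: H. Qed.

Lemma zquot_linl i j l (y : zquot_comp j l) :
  linear (fun x : zquot_comp i j => zquot_mul x y).
Proof.
move=> a; elim/zquot_pi_ind => u; elim/zquot_pi_ind => v.
elim/zquot_pi_ind: y => y.
by rewrite -linearP -!zquot_piM -linearP zmul_linl.
Qed.

Lemma zquot_linr i j l (x : zquot_comp i j) :
  linear (fun y : zquot_comp j l => zquot_mul x y).
Proof.
move=> a; elim/zquot_pi_ind => u; elim/zquot_pi_ind => v.
elim/zquot_pi_ind: x => x.
by rewrite -linearP -!zquot_piM -linearP zmul_linr.
Qed.

Lemma zquot_mulA i j l m (x : zquot_comp i j) (y : zquot_comp j l)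
  (z : zquot_comp l m) : zquot_mul x (zquot_mul y z) = zquot_mul (zquot_mul x y) z.
Proof.
elim/zquot_pi_ind: x => x; elim/zquot_pi_ind: y => y.
by elim/zquot_pi_ind: z => z; rewrite -!zquot_piM zmulA.
Qed.

Lemma zquot_mul1x i j (x : zquot_comp i j) :
  zquot_mul (zquot_pi i i (zone i)) x = x.
Proof. by elim/zquot_pi_ind: x => x; rewrite -zquot_piM zmul1x. Qed.

Lemma zquot_mulx1 i j (x : zquot_comp i j) :
  zquot_mul x (zquot_pi j j (zone j)) = x.
Proof. by elim/zquot_pi_ind: x => x; rewrite -zquot_piM zmulx1. Qed.

Definition zquot : zalg k :=
  ZAlg zquot_linl zquot_linr zquot_mulA zquot_mul1x zquot_mulx1.

End ZQuotient.

Section TensorZAlgebra.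
Variables (k : fieldType) (R : int -> kalg k).
Variable M : forall i, bimod (R i) (R (i + 1)).

(* A word [m_i, ..., m_(j-1), r] with m_t in M_t and r in R_j; it stands for
   the pure tensor m_i (x) ... (x) m_(j-1) r. There is none when j < i. *)
Inductive word : int -> int -> Type :=
| wnil j : R j -> word j j
| wcons i j : M i -> word (i + 1) j -> word i j.

Definition wact i j (r : R i) (w : word i j) : word i j :=
  match w in word i j return R i -> word i j with
  | wnil _ s => fun r => wnil (kmul r s)
  | wcons _ _ m w' => fun r => wcons (lact r m) w'
  end r.

Fixpoint wcat i j l (w : word i j) : word j l -> word i l :=
  match w in word i j return word j l -> word i l with
  | wnil _ r => fun v => wact r v
  | wcons _ _ m w' => fun v => wcons m (wcat w' v)
  end.

Definition fword i j : lmodType k := {freeg {classic word i j} / k}.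

Definition fw i j (w : word i j) : fword i j := << (w : {classic word i j}) >>.

(* Multilinearity and balancedness, in an arbitrary slot of a word. Hence
   [fword i j] modulo these is the iterated tensor product
   M_i (x)_(R_(i+1)) ... (x)_(R_(j-1)) M_(j-1) (x)_(R_j) R_j, i.e. R_i if
   i = j, M_i (x) ... (x) M_(j-1) if i < j, and 0 if j < i. *)
Inductive word_rel : forall i j, fword i j -> Prop :=
| word_linM i l j (u : word i l) a (m m' : M l) (w : word (l + 1) j) :
    word_rel (fw (wcat u (wcons (a *: m + m') w))
      - (a *: fw (wcat u (wcons m w)) + fw (wcat u (wcons m' w))))
| word_linR i j (u : word i j) a (r r' : R j) :
    word_rel (fw (wcat u (wnil (a *: r + r')))
      - (a *: fw (wcat u (wnil r)) + fw (wcat u (wnil r'))))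
| word_bal i l j (u : word i l) (m : M l) (s : R (l + 1)) (w : word (l + 1) j) :
    word_rel (fw (wcat u (wcons (ract m s) w))
      - fw (wcat u (wcons m (wact s w)))).

Lemma wactM i j (r s : R i) (w : word i j) :
  wact (kmul r s) w = wact r (wact s w).
Proof. by case: w r s => [{}j t r s|{}i {}j m w r s] /=; rewrite ?kmulA ?lactA. Qed.

Lemma wact1 i j (w : word i j) : wact (kone (R i)) w = w.
Proof. by case: w => [{}j t|{}i {}j m w] /=; rewrite ?kmul1x ?lact1. Qed.

Lemma wact_cat i j l (r : R i) (u : word i j) (v : word j l) :
  wact r (wcat u v) = wcat (wact r u) v.
Proof. by case: u r v => [{}j s r v|{}i {}j m u r v] //=; rewrite wactM. Qed.

Lemma wcatA i j l m (u : word i j) (v : word j l) (w : word l m) :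
  wcat u (wcat v w) = wcat (wcat u v) w.
Proof. by elim: u v => [{}j r v|{}i {}j x u IH v] /=; rewrite ?wact_cat ?IH. Qed.

Lemma wcat1 i j (u : word i j) : wcat u (wnil (kone (R j))) = u.
Proof. by elim: u => [{}j r|{}i {}j x u IH] /=; rewrite ?kmulx1 ?IH. Qed.

Definition fmul i j l (x : fword i j) (y : fword j l) : fword i l :=
  fglift (fun u : {classic word i j} =>
    fglift (fun v : {classic word j l} => fw (wcat u v)) y) x.

Lemma fmul_linl i j l (y : fword j l) : linear (fun x : fword i j => fmul x y).
Proof. by move=> a u v; rewrite /fmul linearP. Qed.

Lemma fw_ind i j (P : fword i j -> Prop) :
  P 0 -> (forall a w v, P v -> P (a *: fw w + v)) -> forall v, P v.
Proof. exact: (@freeg_ind_lin k {classic word i j} P). Qed.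

Lemma fmul_fwl i j l (u : word i j) (y : fword j l) :
  fmul (fw u) y = fglift (fun v : {classic word j l} => fw (wcat u v)) y.
Proof. by rewrite /fmul /fw liftU scale1r. Qed.

Lemma fmul_fw i j l (u : word i j) (v : word j l) :
  fmul (fw u) (fw v) = fw (wcat u v).
Proof. by rewrite fmul_fwl {1}/fw liftU scale1r. Qed.

Lemma fmul0l i j l (y : fword j l) : fmul (0 : fword i j) y = 0.
Proof. by rewrite /fmul linear0. Qed.

Lemma fmul_linr i j l (x : fword i j) : linear (fun y : fword j l => fmul x y).
Proof.
move=> a y z; elim/fw_ind: x => [|b w v IH].
  by rewrite !fmul0l scaler0 addr0.
rewrite !fmul_linl IH !fmul_fwl linearP !scalerDr !scalerA [b * a]mulrC.
by rewrite -!addrA; congr (_ + _); rewrite addrCA.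
Qed.

Lemma fmul0r i j l (x : fword i j) : fmul x (0 : fword j l) = 0.
Proof.
have := fmul_linr x (-1) (0 : fword j l) 0.
by rewrite !scaleN1r !addNr.
Qed.

Lemma fmulA i j l m (x : fword i j) (y : fword j l) (z : fword l m) :
  fmul x (fmul y z) = fmul (fmul x y) z.
Proof.
elim/fw_ind: x => [|a u x IHx]; first by rewrite !fmul0l.
rewrite !fmul_linl IHx; congr (_ *: _ + _); clear x IHx.
elim/fw_ind: y => [|b v y IHy]; first by rewrite !(fmul0l, fmul0r).
rewrite fmul_linl !fmul_linr fmul_linl IHy; congr (_ *: _ + _); clear y IHy.
elim/fw_ind: z => [|c w z IHz]; first by rewrite !fmul0r.
by rewrite !fmul_linr IHz !fmul_fw wcatA.
Qed.

Definition fone i : fword i i := fw (wnil (kone (R i))).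

Lemma fmul1x i j (x : fword i j) : fmul (fone i) x = x.
Proof.
elim/fw_ind: x => [|a u x IH]; first by rewrite fmul0r.
by rewrite fmul_linr IH fmul_fw /= wact1.
Qed.

Lemma fmulx1 i j (x : fword i j) : fmul x (fone j) = x.
Proof.
elim/fw_ind: x => [|a u x IH]; first by rewrite fmul0l.
by rewrite fmul_linl IH fmul_fw wcat1.
Qed.

Definition word_zalg : zalg k :=
  ZAlg fmul_linl fmul_linr fmulA fmul1x fmulx1.

Definition word_submod i j : submod (fword i j) := span_submod (@word_rel i j).

Lemma word_ideal_l i j l (x : fword i j) (y : fword j l) :
  word_submod j l y -> word_submod i l (fmul x y).
Proof.
move=> Jy; elim/fw_ind: x => [|a u x IH].
  by rewrite fmul0l; exact: span_0.
rewrite fmul_linl; apply: smem_lin => //.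
elim: Jy => {y x IH} [y Jy||b y z _ IHy _ IHz]; first 1 last.
- by rewrite fmul0r; exact: span_0.
- by rewrite fmul_linr; exact: span_lin.
apply: span_gen; case: _ _ y / Jy u => [{}j n {}l v b m m' w|{}j {}l v b r r'|{}j n {}l v m s w] u.
- rewrite (linear_sub (fmul_linr (fw u))) !fmul_fw !wcatA; exact: word_linM.
- rewrite (linear_sub (fmul_linr (fw u))) !fmul_fw !wcatA; exact: word_linR.
- rewrite (linear_sub1 (fmul_linr (fw u))) !fmul_fw !wcatA; exact: word_bal.
Qed.

Lemma word_ideal_r i j l (x : fword i j) (y : fword j l) :
  word_submod i j x -> word_submod i l (fmul x y).
Proof.
move=> Jx; elim/fw_ind: y => [|a u y IH].
  by rewrite fmul0r; exact: span_0.
rewrite fmul_linr; apply: smem_lin => //.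
elim: Jx => {x y IH} [x Jx||b x z _ IHx _ IHz]; first 1 last.
- by rewrite fmul0l; exact: span_0.
- by rewrite fmul_linl; exact: span_lin.
apply: span_gen; case: _ _ x / Jx u => [{}i n {}j v b m m' w|{}i {}j v b r r'|{}i n {}j v m s w] u.
- rewrite (linear_sub (fmul_linl (fw u))) !fmul_fw -!wcatA; exact: word_linM.
- rewrite (linear_sub (fmul_linl (fw u))) !fmul_fw -!wcatA /=.
  case: u v r r' => [{}l s|{}j {}l m w] v r r' /=.
    rewrite kmul_linl; exact: word_linR.
  rewrite lact_linl; exact: word_linM.
- rewrite (linear_sub1 (fmul_linl (fw u))) !fmul_fw -!wcatA /= -wact_cat; exact: word_bal.
Qed.

Definition word_ideal : zideal word_zalg :=
  @ZIdeal k word_zalg word_submod word_ideal_l word_ideal_r.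

Definition tens_zalg : zalg k := zquot word_ideal.

Definition tword i j (w : word i j) : tens_zalg i j :=
  zquot_pi word_ideal i j (fw w).

(* The identification of M_i (x) M_(i+1) with the (i,i+2)-component. *)
Definition tens2 i : tens (M i) (M (i + 1)) -> tens_zalg i (i + 1 + 1) :=
  tens_lift (fun m n => tword (wcons m (wcons n (wnil (kone (R (i + 1 + 1))))))).

Lemma tword_linM i l j (u : word i l) (w : word (l + 1) j) :
  linear (fun m : M l => tword (wcat u (wcons m w))).
Proof.
move=> a m m'; rewrite /tword -linearP; apply/qpi_eqP.
by apply: span_gen; exact: word_linM.
Qed.

Lemma tword_linR i j (u : word i j) : linear (fun r : R j => tword (wcat u (wnil r))).
Proof.
move=> a m m'; rewrite /tword -linearP; apply/qpi_eqP.
by apply: span_gen; exact: word_linR.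
Qed.

Lemma tword_bal i l j (u : word i l) (m : M l) s (w : word (l + 1) j) :
  tword (wcat u (wcons (ract m s) w)) = tword (wcat u (wcons m (wact s w))).
Proof. by apply/qpi_eqP; apply: span_gen; exact: word_bal. Qed.

Lemma tword_cat i j l (u : word i j) (v : word j l) :
  tword (wcat u v) = zmul (tword u) (tword v) :> tens_zalg i l.
Proof. by rewrite /tword -fmul_fw; exact: (@zquot_piM _ word_zalg). Qed.

Lemma tens2_tmk i (m : M i) (n : M (i + 1)) :
  tens2 (tmk m n) = tword (wcons m (wcons n (wnil (kone (R (i + 1 + 1)))))).
Proof.
pose e := wnil (kone (R i)).
have ce j (w : word i j) : wcat e w = w by rewrite /= wact1.
rewrite /tens2 tens_lift_tmk // => [{}n a u v|{}m a u v|{}m s {}n].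
- by have := @tword_linM _ _ _ e (wcons n (wnil (kone _))) a u v; rewrite !ce.
- by have := @tword_linM _ _ _ (wcons m (wnil (kone _))) (wnil (kone _)) a u v;
    rewrite /= !lact1.
- by have := @tword_bal _ _ _ e m s (wcons n (wnil (kone _))); rewrite !ce.
Qed.

End TensorZAlgebra.

Record lincat (k : fieldType) := LinCat {
  obj : Type;
  hom : obj -> obj -> lmodType k;
  mcomp : forall x y z, hom y z -> hom x y -> hom x z;
  idm : forall x, hom x x;
  mcomp_linl : forall x y z (f : hom x y), linear (fun g : hom y z => mcomp g f);
  mcomp_linr : forall x y z (g : hom y z), linear (fun f : hom x y => mcomp g f);
  mcompA : forall x y z t (h : hom z t) (g : hom y z) (f : hom x y),
    mcomp h (mcomp g f) = mcomp (mcomp h g) f;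
  mcomp1m : forall x y (f : hom x y), mcomp (idm y) f = f;
  mcompm1 : forall x y (f : hom x y), mcomp f (idm x) = f
}.
Arguments mcomp {k C x y z} : rename.
Arguments idm {k C} : rename.

Section Abelian.
Variables (k : fieldType) (C : lincat k).

Definition is_zero_obj (z : obj C) : Prop :=
  forall x, (exists! f : hom z x, True) /\ (exists! f : hom x z, True).

Definition is_biproduct (x y b : obj C)
    (i1 : hom x b) (i2 : hom y b) (p1 : hom b x) (p2 : hom b y) : Prop :=
  [/\ mcomp p1 i1 = idm x, mcomp p2 i2 = idm y, mcomp p1 i2 = 0, mcomp p2 i1 = 0
    & mcomp i1 p1 + mcomp i2 p2 = idm b].

Definition is_mono (x y : obj C) (f : hom x y) : Prop :=
  forall w (g h : hom w x), mcomp f g = mcomp f h -> g = h.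

Definition is_epi (x y : obj C) (f : hom x y) : Prop :=
  forall w (g h : hom y w), mcomp g f = mcomp h f -> g = h.

Definition is_kernel (x y z : obj C) (f : hom x y) (u : hom z x) : Prop :=
  mcomp f u = 0 /\
  forall w (g : hom w x), mcomp f g = 0 -> exists! h : hom w z, mcomp u h = g.

Definition is_cokernel (x y z : obj C) (f : hom x y) (u : hom y z) : Prop :=
  mcomp u f = 0 /\
  forall w (g : hom y w), mcomp g f = 0 -> exists! h : hom z w, mcomp h u = g.

Definition abelian_cat : Prop :=
  (exists z, is_zero_obj z) /\
  (forall x y, exists b (i1 : hom x b) (i2 : hom y b) (p1 : hom b x) (p2 : hom b y),
    is_biproduct i1 i2 p1 p2) /\
  (forall x y (f : hom x y), exists z (u : hom z x), is_kernel f u) /\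
  (forall x y (f : hom x y), exists z (u : hom y z), is_cokernel f u) /\
  (forall x y (f : hom x y), is_mono f -> exists z (g : hom y z), is_kernel g f) /\
  (forall x y (f : hom x y), is_epi f -> exists z (g : hom z x), is_cokernel g f).

End Abelian.

Section Sequence.
Variables (k : fieldType) (C : lincat k) (L : int -> obj C).

Definition orbit_comp (i j : int) : lmodType k := hom (L (- j)) (L (- i)).

Definition orbit_mul i j l (f : orbit_comp i j) (g : orbit_comp j l) :
  orbit_comp i l := mcomp f g.

Definition orbit_zalg : zalg k :=
  @ZAlg k orbit_comp orbit_mul (fun i => idm (L (- i)))
    (fun i j l => @mcomp_linl k C _ _ _) (fun i j l => @mcomp_linr k C _ _ _)
    (fun i j l m => @mcompA k C _ _ _ _)
    (fun i j => @mcomp1m k C _ _) (fun i j => @mcompm1 k C _ _).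

Definition endalg (x : obj C) : kalg k :=
  @KAlg k (hom x x) mcomp (idm x) (@mcomp_linl k C x x x) (@mcomp_linr k C x x x)
    (@mcompA k C x x x x) (@mcomp1m k C x x) (@mcompm1 k C x x).

Definition hombimod (x y : obj C) : bimod (endalg y) (endalg x) :=
  @Bimod k (endalg y) (endalg x) (hom x y) mcomp mcomp
    (@mcomp_linl k C x y y) (@mcomp_linr k C x y y)
    (@mcomp_linl k C x x y) (@mcomp_linr k C x x y)
    (fun r r' m => mcompA r r' m) (fun m s s' => esym (mcompA m s s'))
    (@mcomp1m k C x y) (@mcompm1 k C x y) (fun r m s => esym (mcompA r m s)).

(* Indexed by Z-algebra degrees: the (i,i)-component is D_(-i), and the
   generators in the (i,i+1)-component are Hom(L_(-(i+1)), L_(-i)). *)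
Definition diag (i : int) : kalg k := endalg (L (- i)).
Definition gens (i : int) : bimod (diag i) (diag (i + 1)) :=
  hombimod (L (- (i + 1))) (L (- i)).

Definition tens_comp i :
  tens (gens i) (gens (i + 1)) -> hom (L (- (i + 1 + 1))) (L (- i)) :=
  tens_lift (fun (f : gens i) (g : gens (i + 1)) => mcomp f g).

Lemma tens_comp_tmk i (f : gens i) (g : gens (i + 1)) :
  tens_comp (tmk f g) = mcomp f g.
Proof.
rewrite /tens_comp tens_lift_tmk // => [{}g|{}f|{}f s {}g].
- exact: mcomp_linl.
- exact: mcomp_linr.
- by rewrite /= mcompA.
Qed.

Inductive sym_rel : forall i j, tens_zalg gens i j -> Prop :=
| sym_ker i (x : tens (gens i) (gens (i + 1))) :
    tens_comp x = 0 -> sym_rel (tens2 x).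

Definition sym_zalg : zalg k := zquot (zideal_gen sym_rel).

(* The class in S^nc of the pure tensor f_1 (x) ... (x) f_n d, and the
   composite f_1 o ... o f_n o d. *)
Definition sym_word i j (w : word gens i j) : sym_zalg i j :=
  zquot_pi (zideal_gen sym_rel) i j (tword w).

Fixpoint word_comp i j (w : word gens i j) : hom (L (- j)) (L (- i)) :=
  match w in word _ i j return hom (L (- j)) (L (- i)) with
  | wnil _ d => d
  | wcons _ _ f w' => mcomp f (word_comp w')
  end.

End Sequence.

(* Main.v *)
(* Composing the letters of a word is multilinear, balanced and multiplicative,
   so it induces a homomorphism on the tensor Z-algebra; the relations of the
   symmetric algebra are by definition kernels of compositions, hence are
   killed.  As generators raise the degree by one, every word of degree zero is
   a scalar [d], and every word of degree one is [m (x) d = md (x) 1]; hence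
   [d |-> d] and [m |-> m (x) 1] invert the homomorphism on the (i,i)- and
   (i,i+1)-components. *)
Require Import Defs.
From HB Require Import structures.
From mathcomp Require Import all_boot all_algebra.
From mathcomp Require Import zify.
From mathcomp Require Import boolp.
From mathcomp Require Import freeg.
Import GRing.Theory.
Local Open Scope ring_scope.

(** * Homomorphisms out of a quotient $\mathbb{Z}$-algebra *)

Section QuotientHom.
Variables (k : fieldType) (A B : zalg k) (I : zideal A) (F : zhom A B).
Hypothesis F_ideal : forall i j (x : A i j), I i j x -> F i j x = 0.

Definition zquot_lift_fun i j (x : zquot I i j) : B i j := qlift (F i j) x.

Lemma zquot_lift_pi i j (x : A i j) :
  zquot_lift_fun i j (zquot_pi I i j x) = F i j x.
Proof. exact: qlift_pi (@F_ideal i j) x. Qed.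

Lemma zquot_lift_linear i j : linear (zquot_lift_fun i j).
Proof.
move=> a; elim/zquot_pi_ind => x; elim/zquot_pi_ind => y.
by rewrite -linearP !zquot_lift_pi linearP.
Qed.

HB.instance Definition _ i j :=
  GRing.isLinear.Build k (zquot I i j) (B i j) *:%R
    (zquot_lift_fun i j) (zquot_lift_linear i j).

Lemma zquot_liftM i j l (x : zquot I i j) (y : zquot I j l) :
  zquot_lift_fun i l (zmul x y) =
  zmul (zquot_lift_fun i j x) (zquot_lift_fun j l y).
Proof.
elim/zquot_pi_ind: x => x; elim/zquot_pi_ind: y => y.
by rewrite /= -zquot_piM !zquot_lift_pi zmapM.
Qed.

Lemma zquot_lift1 i : zquot_lift_fun i i (zone i) = zone i.
Proof. by rewrite /= zquot_lift_pi zmap1. Qed.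

Definition zquot_lift : zhom (zquot I) B :=
  @ZHom k (zquot I) B (fun i j => zquot_lift_fun i j) zquot_liftM zquot_lift1.

End QuotientHom.
Arguments zquot_lift_pi {k A B} I F.
Arguments zquot_lift {k A B} I F.

Lemma zmul0x (k : fieldType) (A : zalg k) i j l (y : A j l) :
  zmul (0 : A i j) y = 0.
Proof.
have := zmul_linl y (-1) (0 : A i j) 0.
by rewrite !scaleN1r !addNr.
Qed.

Lemma zmulx0 (k : fieldType) (A : zalg k) i j l (x : A i j) :
  zmul x (0 : A j l) = 0.
Proof.
have := zmul_linr x (-1) (0 : A j l) 0.
by rewrite !scaleN1r !addNr.
Qed.

(** The kernel of a homomorphism is a two-sided ideal, so it contains the ideal generated by any [X]
    inside it. *)
Lemma zhom_zspan (k : fieldType) (A B : zalg k) (F : zhom A B)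
    (X : forall i j, A i j -> Prop) :
  (forall i j (x : A i j), X i j x -> F i j x = 0) ->
  forall i j (x : A i j), zspan X x -> F i j x = 0.
Proof.
move=> FX i j x; elim=> {i j x}.
- by move=> i j x /FX.
- by move=> i j; rewrite linear0.
- by move=> i j a x y _ Fx _ Fy; rewrite linearP Fx Fy scaler0 addr0.
- move=> i j l x y _ Fy; rewrite zmapM Fy; exact: zmulx0.
- move=> i j l x y _ Fx; rewrite zmapM Fx; exact: zmul0x.
Qed.

(** * Words of degree zero and one *)

Section Words.
Variables (k : fieldType) (R : int -> kalg k).
Variable M : forall i, bimod (R i) (R (i + 1)).

Lemma word_le {i j} (w : word M i j) : i <= j.
Proof. by elim: w => [//|{}i {}j _ _]; lia. Qed.

Lemma word_diag {i} (w : word M i i) : exists d : R i, w = wnil M d.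
Proof.
(* Case analysis on [w] is blocked by its repeated index, so the endpoints are separated and tied by
   [e]. *)
suff H a j (v : word M a j) (e : j = a) :
    exists d : R j, v = ecast x (word M x j) e (wnil M d).
  exact: H _ _ w erefl.
(* Without letters, [e : j = j] is reflexivity by uniqueness of identity proofs on [int]; with a
   letter, [word_le] gives [a + 1 <= j = a]. *)
case: v e => [{}j d|{}a {}j m v] e; first by exists d; rewrite eq_axiomK.
by have := word_le v; lia.
Qed.

Lemma word_succ {i} (w : word M i (i + 1)) :
  exists (m : M i) (d : R (i + 1)), w = wcons m (wnil M d).
Proof.
suff H a j (v : word M a j) (e : j = a + 1) :
    exists m d, ecast x (word M a x) e v = wcons m (wnil M d).
  exact: H _ _ w erefl.
case: v e => [{}j d|{}a {}j m v] e; first by lia.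
by subst j; have [d ->] := word_diag v; exists m, d.
Qed.

(** The relations carry a prefix word; here it is the unit word, which only multiplies by 1. *)
Lemma tword_wnil_linear i : linear (fun d : R i => tword (wnil M d)).
Proof.
move=> a d d'.
by have := tword_linR (wnil M (kone (R i))) a d d'; rewrite /= !kmul1x.
Qed.

Lemma tword_wcons_linear i j (w : word M (i + 1) j) :
  linear (fun m : M i => tword (wcons m w)).
Proof.
move=> a m m'.
by have := tword_linM (wnil M (kone (R i))) w a m m'; rewrite /= !lact1.
Qed.

(** Balancedness: the closing scalar [d] is [d] acting on the unit word, so it can cross into the
    letter [m]. *)
Lemma tword_ract i (m : M i) (d : R (i + 1)) :
  tword (wcons m (wnil M d)) =
  tword (wcons (ract m d) (wnil M (kone (R (i + 1))))).
Proof.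
have := tword_bal (wnil M (kone (R i))) m d (wnil M (kone _)).
by rewrite /= !lact1 kmulx1.
Qed.

End Words.
Arguments word_diag {k R M i}.
Arguments word_succ {k R M i}.

(** * Composition as a homomorphism on the tensor $\mathbb{Z}$-algebra *)

Section Composition.
Variables (k : fieldType) (C : lincat k) (L : int -> obj C).

Lemma word_comp_act i j (r : diag L i) (w : word (gens L) i j) :
  word_comp (wact r w) = mcomp r (word_comp w).
Proof. by case: w r => [//|{}i {}j m w] r /=; rewrite mcompA. Qed.

Lemma word_comp_cat i j l (u : word (gens L) i j) (v : word (gens L) j l) :
  word_comp (wcat u v) = mcomp (word_comp u) (word_comp v).
Proof.
elim: u v => [{}j r|{}i {}j m u IH] v /=; first exact: word_comp_act.
by rewrite IH mcompA.
Qed.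

Definition fword_comp i j : fword (gens L) i j -> orbit_zalg L i j :=
  fglift (fun w : {classic word (gens L) i j} => word_comp w).

Lemma fword_comp_linear i j : linear (fword_comp i j).
Proof. exact: fglift_lin. Qed.

HB.instance Definition _ i j :=
  GRing.isLinear.Build k (fword (gens L) i j) (orbit_zalg L i j) *:%R
    (fword_comp i j) (fword_comp_linear i j).

Lemma fword_comp_fw i j (w : word (gens L) i j) :
  fword_comp i j (fw w) = word_comp w.
Proof. by rewrite /fword_comp /fw liftU scale1r. Qed.

(** Both sides are bilinear, which reduces the claim to two words and [word_comp_cat]. *)
Lemma fword_compM i j l (x : word_zalg (gens L) i j)
    (y : word_zalg (gens L) j l) :
  fword_comp i l (zmul x y) = zmul (fword_comp i j x) (fword_comp j l y).
Proof.
rewrite /= /orbit_mul; elim/fw_ind: x => [|a u x IHx].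
  rewrite fmul0l !linear0; exact/esym/(@zmul0x k (orbit_zalg L)).
rewrite fmul_linl !fword_comp_linear IHx mcomp_linl.
congr (_ *: _ + _) => {x IHx}.
elim/fw_ind: y => [|a' v y IHy].
  rewrite fmul0r !linear0; exact/esym/(@zmulx0 k (orbit_zalg L)).
rewrite fmul_linr !fword_comp_linear IHy mcomp_linr.
congr (_ *: _ + _) => {y IHy}.
by rewrite fmul_fw !fword_comp_fw word_comp_cat.
Qed.

Lemma fword_comp1 i : fword_comp i i (fone (gens L) i) = zone i.
Proof. exact: fword_comp_fw. Qed.

Definition fword_comp_zhom : zhom (word_zalg (gens L)) (orbit_zalg L) :=
  @ZHom k (word_zalg (gens L)) (orbit_zalg L)
    (fun i j => fword_comp i j) fword_compM fword_comp1.

Lemma fword_comp_rel i j (x : fword (gens L) i j) :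
  word_ideal (gens L) i j x -> fword_comp_zhom i j x = 0.
Proof.
apply: span_ker => {x} v rv; case: _ _ v / rv =>
  [{}i l {}j u a m m' w|{}i {}j u a r r'|{}i l {}j u m s w];
  rewrite /= ?(linear_sub (fword_comp_linear _ _))
    (* Splitting off the prefix leaves bilinearity of composition in the first two cases and its
       associativity in the balanced one. *)
    ?(linear_sub1 (fword_comp_linear _ _)) !fword_comp_fw !word_comp_cat;
  apply/eqP; rewrite subr_eq0; apply/eqP => /=.
- by rewrite mcomp_linl mcomp_linr.
- by rewrite mcomp_linr.
- by rewrite word_comp_act !mcompA.
Qed.

Definition tens_zhom : zhom (tens_zalg (gens L)) (orbit_zalg L) :=
  zquot_lift (word_ideal (gens L)) fword_comp_zhom fword_comp_rel.

Lemma tens_zhom_tword i j (w : word (gens L) i j) :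
  tens_zhom i j (tword w) = word_comp w.
Proof.
rewrite -fword_comp_fw.
exact: zquot_lift_pi (word_ideal (gens L)) fword_comp_zhom fword_comp_rel _ _ _.
Qed.

End Composition.
Arguments tens_zhom {k C}.

(** * The homomorphism on $\mathbb{S}^{nc}$ and its inverses in degrees zero and one *)

Section Symmetric.
Variables (k : fieldType) (C : lincat k) (L : int -> obj C).

Lemma tens_zhom_tens2 i (x : tens (gens L i) (gens L (i + 1))) :
  tens_zhom L i (i + 1 + 1) (tens2 x) = tens_comp x.
Proof.
(* Both lifts evaluate at the same representative of [x], so it suffices to compare linear maps on
   pairs of the free module. *)
rewrite /tens2 /tens_comp /tens_lift /qlift.
move: (qrepr x); elim/freeg_ind_lin => [|a [m n] v IH].
  by rewrite !linear0.
rewrite !fglift_lin linearP IH /= !liftU !scale1r /=; congr (_ *: _ + _).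
by rewrite tens_zhom_tword /= mcompm1.
Qed.

Lemma tens_zhom_sym_rel i j (x : tens_zalg (gens L) i j) :
  zideal_gen (@sym_rel k C L) i j x -> tens_zhom L i j x = 0.
Proof.
apply: zhom_zspan => {i j x} i j x [{}i {}x x0].
by rewrite tens_zhom_tens2.
Qed.

Definition sym_zhom : zhom (sym_zalg L) (orbit_zalg L) :=
  zquot_lift (zideal_gen (@sym_rel k C L)) (tens_zhom L)
    tens_zhom_sym_rel.

Lemma sym_zhom_word i j (w : word (gens L) i j) :
  sym_zhom i j (sym_word w) = word_comp w.
Proof.
rewrite -tens_zhom_tword.
exact: zquot_lift_pi (zideal_gen (@sym_rel k C L)) (tens_zhom L)
  tens_zhom_sym_rel _ _ _.
Qed.

(** Words span the free module and both quotient maps are surjective, so classes of words span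
    $\mathbb{S}^{nc}$. *)
Lemma sym_word_ind i j (P : sym_zalg L i j -> Prop) :
  P 0 -> (forall a w x, P x -> P (a *: sym_word w + x)) -> forall x, P x.
Proof.
move=> P0 PS; elim/zquot_pi_ind; elim/zquot_pi_ind; elim/fw_ind.
  by rewrite !linear0.
by move=> a w x Px; rewrite !linearP; exact: PS.
Qed.

(** As word classes span, a linear right inverse is also a left inverse once this holds on words. *)
Lemma sym_zhom_bij i j (g : orbit_zalg L i j -> sym_zalg L i j) :
  linear g -> (forall f, sym_zhom i j (g f) = f) ->
  (forall w, g (word_comp w) = sym_word w) -> bijective (sym_zhom i j).
Proof.
move=> g_lin gK gw; exists g => //; elim/sym_word_ind => [|a w x IH].
  rewrite linear0.
  by have := g_lin (-1) 0 0; rewrite !scaleN1r !addNr.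
by rewrite linearP g_lin IH sym_zhom_word gw.
Qed.

Lemma sym_zhom_bij0 i : bijective (sym_zhom i i).
Proof.
apply: (@sym_zhom_bij i i (fun d => sym_word (wnil (gens L) d))).
- by move=> a d d'; rewrite /sym_word -linearP -tword_wnil_linear.
- by move=> d; rewrite sym_zhom_word.
- by move=> w; have [d ->] := word_diag w.
Qed.

Lemma sym_zhom_bij1 i : bijective (sym_zhom i (i + 1)).
Proof.
pose e := wnil (gens L) (kone (diag L (i + 1))).
pose g (m : orbit_zalg L i (i + 1)) : sym_zalg L i (i + 1) :=
  sym_word (wcons (m : gens L i) e).
apply: (@sym_zhom_bij i (i + 1) g); rewrite {}/g.
- by move=> a m m'; rewrite /sym_word -linearP -tword_wcons_linear.
- by move=> m; rewrite sym_zhom_word /= mcompm1.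
(* The right action on [gens] is composition, so [ract m d] is the composite of the word [m],
   [d]. *)
- by move=> w; have [m [d ->]] := word_succ w; rewrite /sym_word tword_ract.
Qed.

End Symmetric.

(** The clause on words expresses that [phi] is induced by composition; it determines [phi], since
    word classes span. *)
Theorem proposition2p4 (k : fieldType) (C : lincat k) (abC : abelian_cat C)
    (L : int -> obj C) :
  exists phi : zhom (sym_zalg L) (orbit_zalg L),
    (forall (i j : int) (w : word (gens L) i j),
       phi i j (sym_word w) = word_comp w) /\
    (forall i : int, bijective (phi i i)) /\
    (forall i : int, bijective (phi i (i + 1))).
Proof.
exists (@sym_zhom k C L); split; first exact: sym_zhom_word.
by split; [exact: sym_zhom_bij0 | exact: sym_zhom_bij1].
Qed.
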